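(* Let $k\ge 1$ and let ${\sf V}_k={\sf V}\times[k]$ be the chain of V's poset. The order of rowmotion $\rho$ acting on $\mathcal{J}({\sf V}_k)$ is exactly $2(k+2)$.
   Context: ${\sf V}$ is the 3-element poset with elements $c,\ell,r$ and relations $c<\ell$, $c<r$ ($\ell,r$ incomparable). $[k]=\{1<2<\dots<k\}$ is a chain, and ${\sf V}\times[k]$ carries the product order $(x,i)\le(y,j)$ iff $x\le y$ and $i\le j$. For a finite poset $P$, $\mathcal{J}(P)$ is the set of order ideals (down-closed subsets) of $P$. Rowmotion $\rho:\mathcal{J}(P)\to\mathcal{J}(P)$ sends an order ideal $I$ to the order ideal generated by the minimal elements of $P\setminus I$. The order of $\rho$ is the least $N\ge1$ with $\rho^N=\mathrm{id}$. *)

(* Defs.v *)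
From HB Require Import structures.
From mathcomp Require Import all_boot all_order.

Set Implicit Arguments.
Unset Strict Implicit.
Unset Printing Implicit Defensive.

Import Order.TTheory.
Local Open Scope order_scope.

Inductive V : Type := Vc | Vl | Vr.

Definition V_to_ord (x : V) : 'I_3 :=
  match x with Vc => inord 0 | Vl => inord 1 | Vr => inord 2 end.

Definition V_of_ord (i : 'I_3) : V :=
  match val i with 0 => Vc | 1 => Vl | _ => Vr end.

Lemma V_to_ordK : cancel V_to_ord V_of_ord.
Proof. by case; rewrite /V_of_ord /= inordK. Qed.

HB.instance Definition _ := Equality.copy V (can_type V_to_ordK).
HB.instance Definition _ := Choice.copy V (can_type V_to_ordK).
HB.instance Definition _ := Countable.copy V (can_type V_to_ordK).
HB.instance Definition _ : isFinite V := CanIsFinite V_to_ordK.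

Definition V_le (x y : V) : bool :=
  match x, y with
  | Vc, _ | Vl, Vl | Vr, Vr => true
  | _, _ => false
  end.

Lemma V_le_refl : reflexive V_le.
Proof. by case. Qed.

Lemma V_le_anti : antisymmetric V_le.
Proof. by do 2!case. Qed.

Lemma V_le_trans : transitive V_le.
Proof. by do 3!case. Qed.

Fact V_display : Order.disp_t.
Proof. exact: Order.Disp tt tt. Qed.

HB.instance Definition _ :=
  Order.Le_isPOrder.Build V_display V V_le_refl V_le_anti V_le_trans.

Section Rowmotion.
Variables (d : Order.disp_t) (P : finPOrderType d).
Implicit Types (A I : {set P}).

Definition order_ideal I : bool :=
  [forall x in I, forall y, (y <= x) ==> (y \in I)].

Definition ideals : Type := {I : {set P} | order_ideal I}.

Definition minimal_elements A : {set P} :=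
  [set x in A | [forall y in A, ~~ (y < x)]].

Definition generated_ideal A : {set P} :=
  [set x | [exists y in A, x <= y]].

Lemma generated_idealP A : order_ideal (generated_ideal A).
Proof.
apply/forall_inP => x; rewrite inE => /exists_inP[z zA le_xz].
apply/forallP => y; apply/implyP => le_yx; rewrite inE.
by apply/exists_inP; exists z => //; apply: le_trans le_xz.
Qed.

Definition rowmotion (I : ideals) : ideals :=
  exist _ (generated_ideal (minimal_elements (~: val I)))
    (generated_idealP _).

End Rowmotion.

Definition has_order (T : Type) (f : T -> T) (N : nat) : Prop :=
  [/\ (0 < N)%N, iter N f =1 id
    & forall m : nat, (0 < m)%N -> iter m f =1 id -> (N <= m)%N].

(* The chain [k] = {1 < ... < k} is 'I_k, shifted to {0 < ... < k - 1};
   *p is the componentwise product order. *)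
Definition V_chain (k : nat) : finPOrderType _ := (V *p 'I_k)%type.

Lemma V_chain_leE (k : nat) (p q : V_chain k) :
  (p <= q) = V_le p.1 q.1 && (p.2 <= q.2)%N.
Proof. by []. Qed.

(* Main.v *)
Require Import Defs.
From mathcomp Require Import all_boot all_order.
From mathcomp Require Import zify.

(**
An order ideal of V x [k] is determined by the heights (c, l, r) of its three
fibres, with l, r <= c <= k. In these coordinates rowmotion raises every fibre
by one, except that a side fibre of full height c drops to 0, and that a centre
fibre of height k drops to the height forced by the new side fibres.

The heart of the proof is that the (k+2)-nd iterate of rowmotion is the
reflection exchanging l and r. Rowmotion is injective and commutes with the
reflection, and every orbit meets c = k, so it is enough to follow the
trajectory of (k, l, r) with r <= l, which splits into a few linear runs.
Hence the order divides 2(k+2). It is not smaller, since the orbit of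
(0, 0, 0) has k+2 elements and (1, 1, 0) is not fixed by the reflection.
*)

Set Implicit Arguments.
Unset Strict Implicit.
Unset Printing Implicit Defensive.

(** * Rowmotion in height coordinates *)

Definition heights : Type := (nat * nat * nat)%type.

Definition height (t : heights) (v : V) : nat :=
  let: (c, l, r) := t in match v with Vc => c | Vl => l | Vr => r end.

Definition valid_heights (k : nat) (t : heights) : bool :=
  let: (c, l, r) := t in [&& l <= c, r <= c & c <= k].

Definition swap (t : heights) : heights := let: (c, l, r) := t in (c, r, l).

Definition raise (c h : nat) : nat := if h < c then h.+1 else 0.

Definition row_heights (k : nat) (t : heights) : heights :=
  let: (c, l, r) := t in
  (if c < k then c.+1 else maxn (raise c l) (raise c r), raise c l, raise c r).

Lemma triple_eq (a b c a' b' c' : nat) :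
  a = a' -> b = b' -> c = c' -> (a, b, c) = (a', b', c').
Proof. by move=> -> -> ->. Qed.

Ltac heights_lia :=
  rewrite /row_heights /swap /valid_heights /raise /=;
  repeat (case: ifP => ?); try apply: triple_eq; lia.

Section Heights.
Variable k : nat.
Local Notation row := (row_heights k).

Lemma row_valid t : valid_heights k t -> valid_heights k (row t).
Proof. case: t => [[c l] r]; heights_lia. Qed.

Lemma iter_row_valid n t : valid_heights k t -> valid_heights k (iter n row t).
Proof. by move=> Vt; elim: n => //= n; apply: row_valid. Qed.

Lemma swap_valid t : valid_heights k (swap t) = valid_heights k t.
Proof. case: t => [[c l] r]; heights_lia. Qed.

Lemma swapK : involutive swap.
Proof. by case=> [[c l] r]. Qed.

Lemma row_swap t : row (swap t) = swap (row t).
Proof. case: t => [[c l] r]; heights_lia. Qed.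

Lemma iter_row_swap n t : iter n row (swap t) = swap (iter n row t).
Proof. by elim: n => //= n ->; rewrite row_swap. Qed.

(** The image reveals the branch taken: its centre strictly exceeds both sides if the old centre was
    below [k], and equals the larger side otherwise. This gives the old centre, and a side 0 can
    only come from a side equal to that centre. *)
Lemma row_inj t u :
  valid_heights k t -> valid_heights k u -> row t = row u -> t = u.
Proof.
case: t => [[c l] r]; case: u => [[c' l'] r'].
rewrite /row_heights /valid_heights /raise => Vt Vu [].
by repeat (case: ifP => ?); move=> *; apply: triple_eq; lia.
Qed.

Lemma iter_row_inj n t u : valid_heights k t -> valid_heights k u ->
  iter n row t = iter n row u -> t = u.
Proof.
move=> Vt Vu; elim: n => //= n IHn /row_inj H.
by apply/IHn/H; apply: iter_row_valid.
Qed.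

Lemma iter_row_trans m n t u v :
  iter m row t = u -> iter n row u = v -> iter (m + n) row t = v.
Proof. by move=> <- <-; rewrite addnC iterD. Qed.

(** * Linear runs, during which the centre climbs *)

Lemma run_below s c l r : l < c -> r < c -> c + s <= k ->
  iter s row (c, l, r) = (c + s, l + s, r + s).
Proof.
move=> lc rc; elim: s => [|s IHs] cs /=; first by rewrite !addn0.
rewrite IHs; [heights_lia|lia].
Qed.

(** The first step resets the left fibre to 0, hence [s.-1]. The formula fails at [s = 0], so empty
    runs are split off wherever it is applied. *)
Lemma run_left s c r : 0 < s -> r < c -> c + s <= k ->
  iter s row (c, c, r) = (c + s, s.-1, r + s).
Proof.
case: s => // s _ rc cs.
rewrite iterSr (_ : row _ = (c.+1, 0, r.+1)); last by heights_lia.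
rewrite run_below; [heights_lia|lia..].
Qed.

Lemma run_both s c : 0 < s -> c + s <= k ->
  iter s row (c, c, c) = (c + s, s.-1, s.-1).
Proof.
case: s => // s _ cs.
rewrite iterSr (_ : row _ = (c.+1, 0, 0)); last by heights_lia.
rewrite run_below; [heights_lia|lia..].
Qed.

Lemma run_right s c l : 0 < s -> l < c -> c + s <= k ->
  iter s row (c, l, c) = (c + s, l + s, s.-1).
Proof.
move=> s0 lc cs; rewrite -[(c, l, c)]/(swap (c, c, l)) iter_row_swap.
by rewrite run_left.
Qed.

(** * Reflection after [k.+2] steps *)

Definition reflects t : Prop := iter k.+2 row t = swap t.

(** Since [swap] commutes with [row], the hypothesis is the image of the goal under [iter n row],
    which is injective on valid triples. One point per orbit thus suffices. *)
Lemma reflects_iter n t :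
  valid_heights k t -> reflects (iter n row t) -> reflects t.
Proof.
move=> Vt H; apply: (@iter_row_inj n).
- exact: iter_row_valid.
- by rewrite swap_valid.
by rewrite -iterD addnC iterD H iter_row_swap.
Qed.

Lemma reflects_swap t : reflects (swap t) -> reflects t.
Proof. by rewrite /reflects iter_row_swap swapK => /(congr1 swap); rewrite swapK. Qed.

Lemma reflects_full_left r : r <= k -> reflects (k, k, r).
Proof.
rewrite /reflects leq_eqVlt => /orP[/eqP-> | rk].
  rewrite iterSr (_ : row _ = (0, 0, 0)); last by heights_lia.
  case: (posnP k) => [k0|k0].
    by rewrite /= k0.
  rewrite iterS run_both; [heights_lia|lia..].
have [rk1|rk1] := ltnP r.+1 k.
  have [s ks] : exists s, k = r.+1 + s.+1 by exists (k - r.+2); lia.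
  (* Segment lengths of (k,k,r) -> (r+1,0,r+1) -> (k,s+1,s) -> (s+2,s+2,s+1) -> (k,r,k). *)
  have -> : k.+2 = 1 + (s.+1 + (1 + (r + 1))) by lia.
  apply: (@iter_row_trans _ _ _ (r.+1, 0, r.+1)); first by rewrite /=; heights_lia.
  apply: iter_row_trans; first by apply: run_right; lia.
  apply: (@iter_row_trans _ _ _ (s.+2, s.+2, s.+1)); first by rewrite /=; heights_lia.
  case: (posnP r) => [r0|r0].
    by rewrite r0 /=; heights_lia.
  apply: iter_row_trans.
    by apply: run_left; lia.
  by rewrite /=; heights_lia.
(* Here r+1 = k and the right run is empty: (k,k,r) -> (k,0,k) -> (1,1,0) -> (k,r,k). *)
have ->: k.+2 = 1 + (1 + (r + 1)) by lia.
apply: (@iter_row_trans _ _ _ (k, 0, k)); first by rewrite /=; heights_lia.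
case: (posnP r) => [r0|r0].
  by have -> : k = 1; [lia | rewrite r0].
apply: (@iter_row_trans _ _ _ (1, 1, 0)); first by rewrite /=; heights_lia.
apply: iter_row_trans.
  by apply: run_left; lia.
by rewrite /=; heights_lia.
Qed.

Lemma reflects_full_center l r : r <= l -> l <= k -> reflects (k, l, r).
Proof.
move=> rl; rewrite leq_eqVlt => /orP[/eqP lk | lk].
  by rewrite lk; apply: reflects_full_left; lia.
have Vt : valid_heights k (k, l, r) by heights_lia.
have step1 : iter 1 row (k, l, r) = (l.+1, l.+1, r.+1) by rewrite /=; heights_lia.
have [lk1|lk1] := ltnP l.+1 k; last first.
  apply: (@reflects_iter 1) => //; rewrite step1.
  have -> : l.+1 = k by lia.
  by apply: reflects_full_left; lia.
have [s ks] : exists s, k = l.+1 + s.+1 by exists (k - l.+2); lia.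
case: (ltngtP r l) rl => // [rl|rl] _; last first.
  (* Equal sides stay equal: (k,l,l) -> (l+1,l+1,l+1) -> (k,s,s) -> (s+1,s+1,s+1) -> (k,l,l). *)
  rewrite /reflects; have -> : k.+2 = 1 + (s.+1 + (1 + l.+1)) by lia.
  apply: iter_row_trans step1 _.
  apply: iter_row_trans; first by rewrite rl; apply: run_both; lia.
  apply: (@iter_row_trans _ _ _ (s.+1, s.+1, s.+1)); first by rewrite /=; heights_lia.
  rewrite run_both; [heights_lia|lia..].
have step2 : iter s.+1 row (l.+1, l.+1, r.+1) = (l.+1 + s.+1, s, r.+1 + s.+1).
  by apply: run_left; lia.
have {}step2 := iter_row_trans step1 step2.
have step3 : iter 1 row (l.+1 + s.+1, s, r.+1 + s.+1)
    = (r.+1 + s.+2, s.+1, r.+1 + s.+2) by rewrite /=; heights_lia.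
have {}step3 := iter_row_trans step2 step3.
have [lr|lr] := ltnP r.+1 l; last first.
  (* Here l = r+1, so the point reached is (k,s+1,k), the mirror image of a case already settled. *)
  apply: (@reflects_iter (1 + s.+1 + 1)) => //; rewrite step3.
  apply: reflects_swap; rewrite /swap.
  have -> : r.+1 + s.+2 = k by lia.
  by apply: reflects_full_left; lia.
have [d ld] : exists d, l = r.+1 + d.+1 by exists (l - r.+2); lia.
(* The remaining segments are (r+s+3,s+1,r+s+3) -> (k,s+d+2,d) -> (s+d+3,s+d+3,d+1) -> (k,r,l). *)
rewrite /reflects; have -> : k.+2 = 1 + s.+1 + 1 + (d.+1 + (1 + r.+1)) by lia.
apply: iter_row_trans step3 _.
apply: iter_row_trans; first by apply: run_right; lia.
apply: (@iter_row_trans _ _ _ ((s.+1 + d.+1).+1, (s.+1 + d.+1).+1, d.+1)).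
  by rewrite /=; heights_lia.
rewrite run_left; [heights_lia|lia..].
Qed.

Lemma row_reaches_full t : valid_heights k t ->
  exists n l r, iter n row t = (k, l, r).
Proof.
case: t => [[c l] r] Vt.
have [n] := ubnP (k - c); elim: n c l r Vt => // n IHn c l r Vt cn.
have [ck|ck] := ltnP c k; last first.
  by exists 0, l, r; congr (_, _, _); case/and3P: Vt; lia.
have := row_valid Vt; case E: (row (c, l, r)) => [[c' l'] r'] Vt'.
have [|m [l1 [r1 H]]] := IHn c' l' r' Vt'.
  by move: E; rewrite /row_heights ck => -[] <- _ _; lia.
by exists m.+1, l1, r1; rewrite iterSr E.
Qed.

Lemma iter_row_reflect t : valid_heights k t -> iter k.+2 row t = swap t.
Proof.
move=> Vt; have [n [l [r E]]] := row_reaches_full Vt.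
apply: (reflects_iter Vt (n := n)); rewrite E.
have := iter_row_valid n Vt; rewrite E => /and3P[lk rk _].
have [rl|lr] := leqP r l; first exact: reflects_full_center.
by apply/reflects_swap/reflects_full_center => //; apply: ltnW.
Qed.

(** The centre is [m] up to time [k], and the point at time [k.+1] is (k,k,k). *)
Lemma iter_row0_neq0 m : 0 < k -> 0 < m < k.+2 ->
  iter m row (0, 0, 0) <> (0, 0, 0).
Proof.
case: m => // m k0 mk; have [mk1|mk1] := ltnP m k.
  by rewrite run_both.
have -> : m = k by lia.
rewrite iterS run_both // => -[_]; rewrite /raise; case: ifP; lia.
Qed.

End Heights.

(* [==] on [V] is inherited from ordinals built with [inord] and does not compute. *)
Lemma V_eqE (v w : V) : (v == w) = V_le v w && V_le w v.
Proof. by apply/eqP/idP => [->|/V_le_anti//]; rewrite V_le_refl. Qed.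

(** * Order ideals as triples of heights *)

Section Ideals.
Variable k : nat.
Local Notation P := (V_chain k).
Import Order.TTheory.

Definition ideal_set (t : heights) : {set P} :=
  [set x : P | (x.2 : nat) < height t x.1].

Lemma ideal_setP t : valid_heights k t -> order_ideal (ideal_set t).
Proof.
move=> Vt; apply/forall_inP => x; rewrite inE => xt.
apply/forallP => y; apply/implyP; rewrite V_chain_leE inE => /andP[].
case: t Vt xt => [[c l] r] /=; case: x => v i; case: y => w j /=.
by case: v; case: w => //=; lia.
Qed.

(** If a height of [t] exceeded that of [u], the first element of that fibre outside [ideal_set u]
    would lie in [ideal_set t]. *)
Lemma ideal_set_inj t u : valid_heights k t -> valid_heights k u ->
  ideal_set t = ideal_set u -> t = u.
Proof.
move=> Vt Vu /setP E.
have le_height (a b : heights) v : valid_heights k a ->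
    (forall x : P, x \in ideal_set a -> x \in ideal_set b) ->
    height a v <= height b v.
  move=> Va ab; rewrite leqNgt; apply/negP => ba.
  have bk : height b v < k.
    by apply: leq_trans ba _; case: a Va {ab} => [[c l] r]; case: v; rewrite /=; lia.
  by have := ab (v, Ordinal bk); rewrite !inE /= ba ltnn => /(_ isT).
have H v : height t v = height u v.
  by apply/eqP; rewrite eqn_leq !le_height // => x; rewrite E.
case: t u H {Vt Vu E} => [[c l] r] [[c' l'] r'] H.
by rewrite (H Vc : c = c') (H Vl : l = l') (H Vr : r = r').
Qed.

Lemma ord_downset (A : pred 'I_k) :
  (forall i j : 'I_k, j <= i -> A i -> A j) ->
  exists2 n, n <= k & forall i : 'I_k, A i = (i < n).
Proof.
move=> Adown; pose Q n := [forall i : 'I_k, (n <= i) ==> ~~ A i].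
have exQ : exists n, Q n.
  by exists k; apply/forallP => i; rewrite leqNgt ltn_ord.
case: (ex_minnP exQ) => n /forallP Qn minn.
exists n; first by apply: minn; apply/forallP => i; rewrite leqNgt ltn_ord.
move=> i; case: ltnP => [lt_in | ni]; last exact/negbTE/(implyP (Qn i)).
apply/negPn/negP => nAi; have /minn : Q i; last by rewrite leqNgt lt_in.
by apply/forallP => j; apply/implyP => ij; apply: contra nAi; apply: Adown.
Qed.

Lemma ideal_setE (I : {set P}) : order_ideal I ->
  exists2 t, valid_heights k t & I = ideal_set t.
Proof.
move=> /forall_inP idI.
have Idown (x y : P) : V_le y.1 x.1 -> y.2 <= x.2 -> x \in I -> y \in I.
  move=> v i xI; have /forallP/(_ y)/implyP := idI x xI; apply.
  by rewrite V_chain_leE v.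
have fibre v : exists2 n, n <= k & forall i : 'I_k, ((v, i) \in I) = (i < n).
  apply: (@ord_downset (fun i => (v, i) \in I)) => i j ji.
  by apply: Idown => //; apply: V_le_refl.
have [[[c ck Ic] [l lk Il]] [r rk Ir]] := (fibre Vc, fibre Vl, fibre Vr).
(* Otherwise (v,c) would be in [I] while (Vc,c), which lies below it, is not. *)
have le_c v n : n <= k -> (forall i : 'I_k, ((v, i) \in I) = (i < n)) -> n <= c.
  move=> nk In; rewrite leqNgt; apply/negP => cn.
  have ck' : c < k by apply: leq_trans cn nk.
  have := @Idown (v, Ordinal ck') (Vc, Ordinal ck').
  by rewrite In Ic /= cn ltnn => /(_ isT (leqnn _) isT).
exists (c, l, r); first by rewrite /= (le_c Vl) ?(le_c Vr).
by apply/setP => -[[] i]; rewrite inE /=.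
Qed.

Lemma V_chain_ltE (x y : P) :
  (x < y)%O = V_le x.1 y.1 && ((x.2 : nat) <= y.2)
    && ((x.1 != y.1) || ((x.2 : nat) != y.2)).
Proof.
rewrite lt_neqAle V_chain_leE andbC; congr (_ && _).
by case: x => v i; case: y => w j; rewrite xpair_eqE negb_and.
Qed.

(* The first uncovered element of a side fibre lies above the first uncovered
   element of the centre fibre, hence is not minimal, exactly when l = c. *)
Lemma minimal_elements_ideal_set (t : heights) (x : P) : valid_heights k t ->
  (x \in minimal_elements (~: ideal_set t)) =
  ((x.2 : nat) == height t x.1) && ((x.1 == Vc) || (height t x.1 < height t Vc)).
Proof.
case: t => [[c l] r] Vt; rewrite !inE.
apply/idP/idP => [/andP[xt /forall_inP xmin]|].
  have notbelow (y : P) : height (c, l, r) y.1 <= y.2 -> ~~ (y < x)%O.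
    by move=> H; apply: xmin; rewrite !inE -leqNgt.
  case: x xt notbelow {xmin} => v i; rewrite -leqNgt /= => xt notbelow.
  have hk : height (c, l, r) v < k by apply: leq_ltn_trans xt (ltn_ord i).
  have E : (i : nat) == height (c, l, r) v.
    have := notbelow (v, Ordinal hk) (leqnn _).
    by rewrite V_chain_ltE /= V_le_refl eqxx /= eqn_leq xt /=; lia.
  rewrite E /=; case: (eqVneq v Vc) => //= vc.
  rewrite ltnNge; apply/negP => cv.
  have ck : c < k by apply: leq_ltn_trans cv hk.
  have := notbelow (Vc, Ordinal ck) (leqnn _).
  by rewrite V_chain_ltE /= (eqP E) cv eq_sym vc.
case: x => v i /= /andP[/eqP E H]; rewrite E ltnn /=.
apply/forall_inP => -[w j]; rewrite !inE -leqNgt V_chain_ltE /= => wj.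
move: Vt H E wj; rewrite /valid_heights !V_eqE.
by case: v; case: w => //=; lia.
Qed.

Lemma generated_ideal_row_heights t : valid_heights k t ->
  generated_ideal (minimal_elements (~: ideal_set t)) =
  ideal_set (row_heights k t).
Proof.
case: t => [[c l] r] Vt; apply/setP => -[v i]; rewrite !inE.
apply/exists_inP/idP => [[[w j]]|].
  rewrite minimal_elements_ideal_set // V_chain_leE /= => /andP[/eqP jw H].
  move=> /andP[vw ij]; have := ltn_ord j.
  move: Vt jw H vw ij; rewrite /valid_heights /row_heights /raise V_eqE.
  by case: v; case: w => //=; repeat (case: ifP => ?); rewrite /=; lia.
(* A generator above (v,i) is sought in its own fibre, except when v = Vc and c = k: the centre then
   has no uncovered element, and the larger new side fibre supplies one. *)
move=> iv.
have gen w (wk : height (c, l, r) w < k) : V_le v w -> i <= height (c, l, r) w ->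
    (w == Vc) || (height (c, l, r) w < c) ->
    exists2 y : P, y \in minimal_elements (~: ideal_set (c, l, r))
      & (((v, i) : P) <= y)%O.
  move=> vw iw H; exists (w, Ordinal wk).
    by rewrite minimal_elements_ideal_set //= eqxx.
  by rewrite V_chain_leE /= vw.
move: Vt => /and3P[lc rc ck].
have [vVc|vVc] := eqVneq v Vc; last first.
  have ivc : (i <= height (c, l, r) v) && (height (c, l, r) v < c).
    case: v iv vVc {gen} => /=; rewrite /raise V_eqE /= => + //;
      by case: ifP; lia.
  have /andP[iv' vc] := ivc.
  apply: (gen v) => //; last by rewrite vc orbT.
    exact: leq_trans vc ck.
  exact: V_le_refl.
move: iv gen; rewrite {}vVc {v} => /= iv gen.
have [c_k|k_c] := ltnP c k.
  by move: iv; rewrite c_k => iv; apply: (gen Vc); rewrite ?eqxx.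
move: iv; rewrite [c < k]ltnNge k_c leq_max
  => /orP[] iv; [apply: (gen Vl)|apply: (gen Vr)] => //=;
  by move: iv; rewrite /raise; case: ifP; lia.
Qed.

Lemma iter_rowmotion t n (I : ideals P) : valid_heights k t ->
  val I = ideal_set t ->
  val (iter n (@rowmotion _ P) I) = ideal_set (iter n (row_heights k) t).
Proof.
move=> Vt It; elim: n => //= n ->.
by apply: generated_ideal_row_heights; apply: iter_row_valid.
Qed.

End Ideals.

Theorem theorem3p2 (k : nat) (hk : 1 <= k) :
  has_order (@rowmotion _ (V_chain k)) (2 * (k + 2)).
Proof.
have -> : 2 * (k + 2) = k.+2 + k.+2 by lia.
split=> // [I | m m0 rowm].
  have [t Vt It] := ideal_setE (valP I).
  apply: val_inj; rewrite (iter_rowmotion _ Vt It) iterD !iter_row_reflect //.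
    by rewrite swapK.
  by rewrite swap_valid.
have fixed t : valid_heights k t -> iter m (row_heights k) t = t.
  move=> Vt; pose I : ideals (V_chain k) := exist _ (ideal_set k t) (ideal_setP Vt).
  apply: (@ideal_set_inj k) => //; first exact: iter_row_valid.
  by rewrite -(iter_rowmotion m Vt (erefl : val I = _)) rowm.
have fixed0 := fixed (0, 0, 0) isT.
rewrite leqNgt; apply/negP => mk.
have [mk2|mk2|mk2] := ltngtP m k.+2.
- by apply: (iter_row0_neq0 hk) fixed0; rewrite m0.
(* (0,0,0) is its own reflection, so removing [k.+2] steps still fixes it. *)
- apply: (@iter_row0_neq0 k (m - k.+2)) => //; first by lia.
  by rewrite -[RHS]fixed0 -{2}(subnK (ltnW mk2)) iterD iter_row_reflect.
(* Validity of (1,1,0) computes to [1 <= k]. *)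
- have := fixed (1, 1, 0) hk.
  by rewrite mk2 iter_row_reflect.
Qed.
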